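(* Let $b\ge1$, let $n\ge 1$, let $\mathcal{C}=\{C_1,\dots,C_b\}$, and let $\sigma$ be a permutation of $\{1,\dots,b\}$. Then the number $JS(\sigma,n,\mathcal{C})$ of juggling card sequences $A$ of length $n$ with all cards from $\mathcal{C}$ and with $\pi_A=\sigma$ equals \[ JS(\sigma,n,\mathcal{C})=\sum_{k=b-L(\sigma)}^{b}\left\{ {n \atop k} \right\}, \] where $\left\{ {n \atop k} \right\}$ denotes the Stirling number of the second kind (number of partitions of $\{1,\dots,n\}$ into $k$ nonempty blocks).
   Context: There are $b$ balls on levels $1,\dots,b$. For $1\le i\le b$ the card $C_i$ induces the permutation $\pi_{C_i}$ of $[b]$ with $\pi_{C_i}(1)=i$, $\pi_{C_i}(j)=j-1$ for $2\le j\le i$, and $\pi_{C_i}(j)=j$ for $i<j\le b$ (a ball at level $j$ on the left of the card ends on level $\pi_{C_i}(j)$ on the right). A juggling card sequence of length $n$ is a word $A=C_{i_1}C_{i_2}\cdots C_{i_n}$; starting with ball $j$ at level $j$ for all $j$ and passing through the cards from left to right, $\pi_A(j)$ is the final level of ball $j$, i.e. $\pi_A=\pi_{C_{i_n}}\circ\cdots\circ\pi_{C_{i_1}}$. For a permutation $\sigma$ of $[b]$, $L(\sigma)$ is the largest $\ell$ such that $\sigma(b-\ell+1)<\cdots<\sigma(b-1)<\sigma(b)$. *)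

(* Defs.v *)
From mathcomp Require Import all_boot all_fingroup.

Set Implicit Arguments.
Unset Strict Implicit.
Unset Printing Implicit Defensive.

(* Levels, balls and cards are numbered from 0: [j : 'I_b] is level (or ball)
   j + 1, and [i : 'I_b] as a card is C_(i+1). *)

Lemma pred_ord_subproof b (j : 'I_b) : j.-1 < b.
Proof. exact: leq_ltn_trans (leq_pred j) (ltn_ord j). Qed.

Definition card_fun b (i j : 'I_b) : 'I_b :=
  if j == 0 :> nat then i
  else if j <= i then Ordinal (pred_ord_subproof j)
  else j.

Lemma card_fun_inj b (i : 'I_b) : injective (card_fun i).
Proof.
move=> [j hj] [k hk]; rewrite /card_fun /=.
case: j hj => [|j] hj; case: k hk => [|k] hk /=.
- by move=> _; apply: val_inj.
- case: ifP => le_ki /(congr1 val) /= eq_ik.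
    by rewrite eq_ik ltnn in le_ki.
  by rewrite eq_ik leqnn in le_ki.
- case: ifP => le_ji /(congr1 val) /= eq_ji.
    by rewrite -eq_ji ltnn in le_ji.
  by rewrite -eq_ji leqnn in le_ji.
case: ifP => le_ji; case: ifP => le_ki /(congr1 val) /= eq_jk.
- by apply: val_inj => /=; rewrite eq_jk.
- by rewrite eq_jk in le_ji; rewrite (ltnW le_ji) in le_ki.
- by rewrite -eq_jk in le_ki; rewrite (ltnW le_ki) in le_ji.
by apply: val_inj.
Qed.

Definition card_perm b (i : 'I_b) : {perm 'I_b} := perm (@card_fun_inj b i).

(* In {perm T}, (s * t) x = t (s x): the first card of the word acts first. *)
Definition word_perm b (A : seq 'I_b) : {perm 'I_b} :=
  (\prod_(i <- A) card_perm i)%g.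

Definition JS b (s : {perm 'I_b}) (n : nat) (C : {set 'I_b}) : nat :=
  #|[set A : n.-tuple 'I_b | all (mem C) A & word_perm A == s]|.

Definition all_cards b : {set 'I_b} := [set: 'I_b].

Definition perm_word b (s : {perm 'I_b}) : seq nat :=
  [seq val (s j) | j <- enum 'I_b].

Definition increasing_suffix b (s : {perm 'I_b}) (l : nat) : bool :=
  sorted ltn (drop (b - l) (perm_word s)).

Definition L b (s : {perm 'I_b}) : nat :=
  \max_(l < b.+1 | increasing_suffix s l) l.

Definition stirling2 (n k : nat) : nat :=
  #|[set P : {set {set 'I_n}} | partition P [set: 'I_n] & #|P| == k]|.

(* Main.v *)
Require Import Defs.
From mathcomp Require Import all_boot all_fingroup.

(* Name each ball by the level on which it ends, so that the balls start in the
   order pi_A(1), ..., pi_A(b).  A word of cards is determined by the sequence x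
   of the names of the balls thrown, and x can be any sequence of names: read
   backwards, each card moves an arbitrary ball to the front.  Initially the
   balls that get thrown are below the others, in the order of their first
   throws, and the balls never thrown are in increasing order of their names.
   Hence pi_A = sigma iff, for some k, the first occurrences in x are
   sigma(1), ..., sigma(k) and sigma(k+1) < ... < sigma(b), i.e. k >= b - L(sigma).
   Finally, a sequence with prescribed first occurrences (u_1, ..., u_k) is the
   same as a partition of {1, ..., n} into k blocks, the sets of positions
   carrying equal letters. *)

Fixpoint first_occ {T : eqType} (s : seq T) : seq T :=
  if s is x :: s' then x :: [seq y <- first_occ s' | y != x] else [::].

Lemma mem_first_occ {T : eqType} (s : seq T) : first_occ s =i s.
Proof.
elim: s => //= x s IH y; rewrite !inE mem_filter IH.
by case: eqP.
Qed.

Lemma first_occ_uniq {T : eqType} (s : seq T) : uniq (first_occ s).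
Proof. by elim: s => //= x s IH; rewrite mem_filter eqxx /= filter_uniq. Qed.

Lemma first_occ_map {T1 T2 : eqType} (g : T1 -> T2) (s : seq T1) :
  {in s &, injective g} -> first_occ (map g s) = map g (first_occ s).
Proof.
elim: s => //= x s IH g_inj; rewrite IH; last first.
  by move=> y z ys zs; apply: g_inj; rewrite inE ?ys ?zs orbT.
rewrite filter_map; congr (_ :: map _ _); apply: eq_in_filter => y /=.
rewrite mem_first_occ => ys; rewrite (inj_in_eq g_inj) ?mem_head //.
by rewrite inE ys orbT.
Qed.

Lemma eq_preim_partition {I : finType} {T1 T2 : eqType} (f1 : I -> T1)
    (f2 : I -> T2) (D : {set I}) :
  preim_partition f1 D = preim_partition f2 D ->
  {in D &, forall i j, (f1 i == f1 j) = (f2 i == f2 j)}.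
Proof.
move=> eqP12 i j iD jD.
have E (T : eqType) (f : I -> T) :
    (j \in pblock (preim_partition f D) i) = (f i == f j).
  rewrite pblock_equivalence_partition //.
  by split=> //= /eqP ->.
by rewrite -!E eqP12.
Qed.

Lemma card_preim_partition {I T : finType} (f : I -> T) (D : {set I}) :
  #|preim_partition f D| = #|f @: D|.
Proof.
rewrite -(card_in_imset (f := fun y => [set j in D | y == f j])).
  by rewrite -imset_comp; congr #|pred_of_set _|; apply: eq_imset.
move=> y z /imsetP[i iD ->] _ /setP/(_ i).
by rewrite !inE iD eqxx => /esym/eqP.
Qed.

(** Sending [x] to its kernel partition is a bijection: [u] gives the blocks their letters in order
    of least positions. *)
Lemma card_first_occ {T : finType} (n : nat) (u : seq T) : uniq u ->
  #|[set x : n.-tuple T | first_occ x == u]| = stirling2 n (size u).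
Proof.
move=> u_uniq; rewrite /stirling2.
pose F (x : n.-tuple T) := preim_partition (tnth x) [set: 'I_n].
rewrite -(card_in_imset (f := F)); last first.
  move=> x x'; rewrite !inE => /eqP xu /eqP x'u eqF.
  have ker i j : (tnth x i == tnth x j) = (tnth x' i == tnth x' j).
    by apply: (eq_preim_partition _ _ _ eqF); rewrite inE.
  (* [h] transports the letters of x to those of x' at the same positions. *)
  pose h y := oapp (tnth x') y [pick i | tnth x i == y].
  have hx i : h (tnth x i) = tnth x' i.
    rewrite /h; case: pickP => [j|/(_ i)]; last by rewrite eqxx.
    by rewrite ker => /eqP.
  have x'E : tval x' = map h x.
    rewrite -{1}(map_tnth_enum x') -{1}(map_tnth_enum x) -map_comp.
    by apply: eq_map => i /=; rewrite hx.
  have h_inj : {in x &, injective h}.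
    move=> _ _ /tnthP[i ->] /tnthP[j ->]; rewrite !hx => /eqP.
    by rewrite -ker => /eqP.
  (* [h] carries the first occurrences in [x] to those in [x']; both lists are [u], so [h] fixes
     each letter of [u]. *)
  have hu : map h u = u by rewrite -{2}x'u x'E first_occ_map // xu.
  apply: val_inj; rewrite /= x'E -[LHS]map_id; apply/eq_in_map => y yx.
  have /(nthP y)[k k_lt <-] : y \in u by rewrite -xu mem_first_occ.
  by rewrite -[RHS](nth_map y y) ?hu.
apply: eq_card => P; rewrite [RHS]inE.
apply/imsetP/andP => [[x]|[P_part /eqP P_card]].
  rewrite inE => /eqP xu ->; split; first exact: preim_partitionP.
  rewrite card_preim_partition -xu -(card_uniqP _) ?first_occ_uniq //.
  apply/eqP/eq_card => y; rewrite mem_first_occ.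
  apply/imsetP/tnthP => [[i _ ->]|[i ->]]; first by exists i.
  by exists i.
(* It suffices to find any sequence with kernel P, here over the alphabet of
   blocks, and to rename its letters in order of first occurrence. *)
pose x0 := [tuple pblock P i | i < n].
have x0P : preim_partition (tnth x0) setT = P.
  rewrite -[RHS](preim_partition_pblock P_part); apply: eq_in_imset => i _.
  by apply/setP => j; rewrite !inE !tnth_mktuple.
clearbody x0.
have u0_size : size (first_occ x0) = size u.
  rewrite -P_card -x0P card_preim_partition -(card_uniqP (first_occ_uniq _)).
  apply: eq_card => y; rewrite mem_first_occ.
  apply/tnthP/imsetP => [[i ->]|[i _ ->]]; first by exists i.
  by exists i.
(* [nth] needs a default letter [y0]; an empty [u] forces [n = 0]. *)
case: u => [|y0 u'] in u_uniq u0_size P_card *.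
  have n0 : n = 0.
    by have := size_tuple x0; case: (tval x0) u0_size => // _ <-.
  have nilP : @size T [::] == n by rewrite n0.
  exists (Tuple nilP); rewrite ?inE // -x0P; apply: eq_in_imset => i.
  by have := leq_trans (ltn_ord i) (eq_leq n0).
set u := y0 :: u' in u_uniq u0_size P_card *.
(* The k-th block met in [x0] gets the k-th letter of [u]; the default is never returned on letters
   of [x0]. *)
pose g B := nth y0 u (index B (first_occ x0)).
have g_inj : {in x0 &, injective g}.
  move=> B C Bx Cx /eqP.
  rewrite nth_uniq -?u0_size ?index_mem ?mem_first_occ // => /eqP.
  by move=> /(congr1 (nth B (first_occ x0))); rewrite !nth_index ?mem_first_occ.
exists (map_tuple g x0).
  rewrite inE first_occ_map //=; apply/eqP/(eq_from_nth (x0 := y0)).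
    by rewrite size_map.
  move=> k; rewrite size_map => k_lt.
  by rewrite (nth_map set0) // /g index_uniq ?first_occ_uniq.
rewrite -x0P; apply: eq_in_imset => i _; apply/setP => j; rewrite !inE !tnth_map.
by rewrite (inj_in_eq g_inj) ?mem_tnth.
Qed.

Definition ord_ltn {b : nat} : rel 'I_b := relpre val ltn.

Lemma enum_ord_sorted (b : nat) : sorted ord_ltn (enum 'I_b).
Proof. by rewrite -sorted_map val_enum_ord iota_ltn_sorted. Qed.

Lemma eq_ord_sorted (b : nat) (u v : seq 'I_b) :
  sorted ord_ltn u -> sorted ord_ltn v -> u =i v -> u = v.
Proof.
apply: irr_sorted_eq => [y x z|x]; first exact: ltn_trans.
exact: ltnn.
Qed.

Lemma filter_ord_sorted (b : nat) (p : pred 'I_b) :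
  sorted ord_ltn [seq j <- enum 'I_b | p j].
Proof.
apply: sorted_filter (enum_ord_sorted b) => y x z; exact: ltn_trans.
Qed.

Lemma map_card_perm (b : nat) (i : 'I_b) :
  [seq Defs.card_perm i j | j <- enum 'I_b] = i :: [seq j <- enum 'I_b | j != i].
Proof.
case: b i => [[]//|b] i.
(* Past level 0 the card acts as [lift i], which enumerates the levels other than [i] in increasing
   order. *)
have -> : [seq j <- enum 'I_b.+1 | j != i] = map (lift i) (enum 'I_b).
  apply: eq_ord_sorted; first exact: filter_ord_sorted.
    apply: homo_sorted (enum_ord_sorted b) => j k; rewrite /ord_ltn /=.
    by rewrite !ltnNge leq_bump2.
  move=> j; rewrite mem_filter mem_enum andbT; apply/idP/mapP => [|[k _ ->]].
    rewrite eq_sym => /unlift_some[k -> _].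
    by exists k; rewrite ?mem_enum.
  by rewrite eq_sym neq_lift.
rewrite enum_ordSl /= permE; congr (_ :: _); rewrite -map_comp.
apply: eq_map => j; rewrite /= permE; apply: val_inj; rewrite /card_fun /=.
by rewrite /bump /=; case: leqP.
Qed.

(* Each ball is named by its final level: the ball thrown by the card [i]
   lands on level [i], and the cards after it take it to [word_perm A' i]. *)
Fixpoint thrown {b : nat} (A : seq 'I_b) : seq 'I_b :=
  if A is i :: A' then word_perm A' i :: thrown A' else [::].

Lemma word_perm_cons (b : nat) (i : 'I_b) (A : seq 'I_b) :
  word_perm (i :: A) = (Defs.card_perm i * word_perm A)%g.
Proof. exact: big_cons. Qed.

Lemma size_thrown (b : nat) (A : seq 'I_b) : size (thrown A) = size A.
Proof. by elim: A => //= i A ->. Qed.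

(** Decoding runs from the end: the tail fixes [word_perm A], whose injectivity yields the first
    card. *)
Lemma thrown_inj (b : nat) : injective (@thrown b).
Proof.
elim=> [|i A IH] [|i' A'] //= [+ /IH eqA].
by rewrite eqA => /perm_inj ->.
Qed.

Definition untouched {b : nat} (x : seq 'I_b) : seq 'I_b :=
  [seq j <- enum 'I_b | j \notin x].

(** Prepending a card moves one name to the front and keeps the order of the others, as prepending
    that letter does on the right. *)
Lemma map_word_perm (b : nat) (A : seq 'I_b) :
  [seq word_perm A j | j <- enum 'I_b]
    = first_occ (thrown A) ++ untouched (thrown A).
Proof.
elim: A => [|i A IH] /=.
  rewrite /untouched filter_predT -[RHS]map_id; apply: eq_map => j.
  by rewrite /word_perm big_nil perm1.
have -> : [seq word_perm (i :: A) j | j <- enum 'I_b]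
    = map (word_perm A) [seq Defs.card_perm i j | j <- enum 'I_b].
  by rewrite -map_comp; apply: eq_map => j; rewrite word_perm_cons permM.
rewrite map_card_perm /=; congr (_ :: _).
have -> : [seq j <- enum 'I_b | j != i]
    = [seq j <- enum 'I_b | word_perm A j != word_perm A i].
  by apply: eq_filter => j; rewrite (inj_eq perm_inj).
rewrite -(filter_map (word_perm A) (fun y => y != word_perm A i)) IH filter_cat.
congr (_ ++ _); rewrite -filter_predI; apply: eq_filter => j /=.
by rewrite inE negb_or.
Qed.

Lemma JS_thrown (b n : nat) (s : {perm 'I_b}) :
  JS s n (all_cards b) =
  #|[set x : n.-tuple 'I_b |
      first_occ x ++ untouched x == [seq s j | j <- enum 'I_b]]|.
Proof.
have szP (A : n.-tuple 'I_b) : size (thrown A) == n.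
  by rewrite size_thrown size_tuple.
pose f A := Tuple (szP A).
have f_inj : injective f by move=> A A' [/thrown_inj/val_inj].
(* An injective self-map of a finite type is bijective. *)
rewrite -(card_preimset _ f_inj); congr #|pred_of_set _|; apply/setP => A.
rewrite !inE -map_word_perm.
have -> /= : all (mem (all_cards b)) A by apply/allP => i; rewrite !inE.
apply/eqP/eqP => [-> //|/eq_in_map eqs]; apply/permP => j.
by apply: eqs; rewrite mem_enum.
Qed.

(** Suffixes of an increasing list are increasing, so the lengths that qualify are exactly those up
    to [L s]. *)
Lemma increasing_suffixE (b k : nat) (s : {perm 'I_b}) : k <= b ->
  sorted ord_ltn (drop k [seq s j | j <- enum 'I_b]) = (b - L s <= k).
Proof.
move=> k_le.
have E l : increasing_suffix s l
    = sorted ord_ltn (drop (b - l) [seq s j | j <- enum 'I_b]).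
  by rewrite -sorted_map map_drop -map_comp.
have Ls : increasing_suffix s (L s).
  have [|l l_inc Ll] := @eq_bigmax_cond 'I_b.+1 (fun l => increasing_suffix s l) val.
    apply/card_gt0P; exists ord0.
    by rewrite /in_mem /= E subn0 drop_oversize // size_map size_enum_ord.
  by have -> : L s = l by exact: Ll.
apply/idP/idP => [inc|le_k].
  rewrite leq_subCl; have lt_b : b - k < b.+1 by rewrite ltnS leq_subr.
  by apply: (bigmax_sup (Ordinal lt_b)); rewrite ?E ?subKn.
rewrite -(subnK le_k) -drop_drop; by apply: drop_sorted; rewrite -E.
Qed.

(** As [w] lists each letter once, the letters outside [take k w] are those of [drop k w], and their
    increasing order is unique. *)
Lemma first_occ_untouchedP (b : nat) (x w : seq 'I_b) :
  w =i 'I_b -> uniq w ->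
  reflect (exists2 k, first_occ x = take k w & sorted ord_ltn (drop k w))
    (first_occ x ++ untouched x == w).
Proof.
move=> w_full w_uniq; apply: (iffP eqP) => [<-|[k xk w_sorted]].
  exists (size (first_occ x)); rewrite ?take_size_cat // drop_size_cat //.
  exact: filter_ord_sorted.
rewrite -[RHS](cat_take_drop k) xk; congr (_ ++ _).
apply: eq_ord_sorted => [|//|y]; first exact: filter_ord_sorted.
rewrite mem_filter mem_enum andbT -mem_first_occ xk.
have := w_uniq; rewrite -{1}(cat_take_drop k w) cat_uniq => /and3P[_ /hasPn dis _].
have := w_full y; rewrite -{1}(cat_take_drop k w) mem_cat inE.
by case: (boolP (y \in drop k w)) => [/dis ->|_]; rewrite ?orbF //= => ->.
Qed.

Theorem theorem2p3 (b n : nat) (s : {perm 'I_b}) (hb : 1 <= b) (hn : 1 <= n) :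
  JS s n (all_cards b) = \sum_(b - L s <= k < b.+1) stirling2 n k.
Proof.
rewrite JS_thrown; set w := [seq s j | j <- enum 'I_b].
have w_size : size w = b by rewrite size_map size_enum_ord.
have w_uniq : uniq w by rewrite (map_inj_uniq perm_inj) enum_uniq.
have w_full : w =i 'I_b.
  by move=> y; apply/mapP; exists ((s^-1)%g y); rewrite ?mem_enum ?permKV.
have take_size k : k <= b -> size (take k w) = k.
  by move=> k_le; rewrite size_takel ?w_size.
have first_occ_size (x : seq 'I_b) : size (first_occ x) <= b.
  by rewrite -[leqRHS](card_ord b) -(card_uniqP (first_occ_uniq x)) max_card.
rewrite -sum1_card big_geq_mkord /=.
(* Group by the number of distinct letters; it is at most [b], so [inord] preserves it. *)
rewrite (partition_big (fun x : n.-tuple 'I_b => inord (size (first_occ x)))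
  (fun k : 'I_b.+1 => b - L s <= k)); last first.
  move=> x; rewrite inE => /eqP xw; rewrite inordK ?ltnS //.
  rewrite -increasing_suffixE // -/w -xw drop_size_cat //.
  exact: filter_ord_sorted.
apply: eq_bigr => k; have k_le : k <= b by rewrite -ltnS.
rewrite -increasing_suffixE // -/w => k_sorted.
rewrite -(take_size k) // -card_first_occ ?take_uniq // -sum1_card.
apply: eq_bigl => x; rewrite !inE.
apply/andP/eqP => [[/eqP xw /eqP <-]|xk].
  by rewrite inordK ?ltnS // -xw take_size_cat.
split; first by apply/first_occ_untouchedP => //; exists k.
by rewrite xk take_size // inord_val.
Qed.
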